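(* Let $k \geq 3$ and $m \geq 1$ be integers. Let $G$ be an edge-colored graph on $n \geq km$ vertices. If $$e(G)+c(G) \geq \binom{n-k(m-1)}{2} + \operatorname{rb}(K_{n-k(m-1)}, K_k) + k(m-1)(2n-1) - k^2(m-1)^2,$$ then $G$ contains $m$ (pairwise) vertex-disjoint rainbow $K_k$ subgraphs.
   Context: All graphs are finite and simple. An edge-colored graph is a graph $G$ together with an arbitrary map $C:E(G)\to\mathbb{N}$ (not necessarily a proper coloring). $e(G)=|E(G)|$ is the number of edges, and $c(G)=|C(E(G))|$ is the number of distinct colors appearing on the edges of $G$. An edge-colored graph is rainbow if no two of its edges share the same color. $K_n$ is the complete graph on $n$ vertices. A rainbow $K_k$ in $G$ is a subgraph of $G$ isomorphic to $K_k$ that is rainbow under the coloring of $G$. Subgraphs are vertex-disjoint if any two different ones have disjoint vertex sets (different subgraphs may share colors). For graphs $G,H$, $\operatorname{rb}(G,H)$ denotes the minimum number of colors such that every edge coloring of $G$ with at least $\operatorname{rb}(G,H)$ colors contains a rainbow $H$. *)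

(* Defs.v *)
From mathcomp Require Import all_boot.
From mathcomp Require Import boolp.

Set Implicit Arguments.
Unset Strict Implicit.
Unset Printing Implicit Defensive.

Record sgraph := SGraph {
  vertex :> finType;
  adj : rel vertex;
  adj_sym : symmetric adj;
  adj_irrefl : irreflexive adj }.

Definition edges (G : sgraph) : {set {set G}} :=
  [set e | [exists x, exists y, adj x y && (e == [set x; y])]].

Lemma complete_sym (n : nat) : symmetric (fun x y : 'I_n => x != y).
Proof. by move=> x y; rewrite eq_sym. Qed.

Lemma complete_irrefl (n : nat) : irreflexive (fun x y : 'I_n => x != y).
Proof. by move=> x; rewrite eqxx. Qed.

Definition complete (n : nat) : sgraph :=
  SGraph (@complete_sym n) (@complete_irrefl n).

(* Colorings are total on vertex sets, but every notion below reads them only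
   on edges, so that the values off the edges are irrelevant. *)
Definition coloring (G : sgraph) := {set G} -> nat.

Definition ncolors (G : sgraph) (C : coloring G) : nat :=
  size (undup [seq C e | e in edges G]).

Record subgraph (G : sgraph) := Subgraph {
  sverts : {set G};
  sedges : {set {set G}};
  sedges_edges : sedges \subset edges G;
  sedges_sverts : {in sedges, forall e : {set G}, e \subset sverts} }.

Definition is_copy (G H : sgraph) (S : subgraph G) : Prop :=
  exists f : H -> G,
    [/\ injective f,
        f @: [set: H] = sverts S
      & [set f @: (e : {set H}) | e in edges H] = sedges S].

Definition rainbow (G : sgraph) (C : coloring G) (S : subgraph G) : Prop :=
  {in sedges S &, injective C}.

Definition is_rainbow_copy (G H : sgraph) (C : coloring G) (S : subgraph G) :
  Prop := is_copy H S /\ rainbow C S.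

Definition forces_rainbow (G H : sgraph) (r : nat) : Prop :=
  forall C : coloring G, r <= ncolors C ->
    exists S : subgraph G, is_rainbow_copy H C S.

(* The minimum always exists: no coloring uses more than #|edges G| colors. *)
Lemma forces_rainbow_ex (G H : sgraph) :
  exists r, `[< forces_rainbow G H r >].
Proof.
exists #|edges G|.+1; apply/asboolP => C.
rewrite ltnNge => /negP[]; apply: leq_trans (size_undup _) _.
by rewrite size_map -cardE.
Qed.

Definition rb (G H : sgraph) : nat := ex_minn (forces_rainbow_ex G H).

Lemma rbP (G H : sgraph) :
  forces_rainbow G H (rb G H) /\
  forall r, forces_rainbow G H r -> rb G H <= r.
Proof.
rewrite /rb; case: ex_minnP => r /asboolP fr rmin.
by split=> // s fs; apply: rmin; apply/asboolP.
Qed.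

(* Main.v *)
(** Since [2 * ('C(n, 2) - 'C(N, 2)) = k(m-1)(2n-1) - k^2(m-1)^2] for
    [N = n - k(m-1)], deleting [k(m-1)] vertices lowers [e + c] by at most this
    amount, so every [N]-subset [B] of [G] satisfies
    [e(B) + c(B) >= 'C(N, 2) + rb(K_N, K_k)].  It is thus enough to find a
    rainbow [K_k] in every such [B] and to choose copies greedily.

    Put [r = k - 2] and let [t] be the number of edges of the Turan graph with
    [r] parts on [N] vertices.  The Turan coloring gives [rb >= t + 2] for
    [r >= 2], and the coloring by the larger endpoint gives [rb >= N] for
    [r = 1].  The bound [e + c >= 'C(N, 2) + t + 2] (resp. ['C(N, 2) + N])
    forces a rainbow [K_k], by induction on [N]: delete a vertex [v], which
    loses [d(v)] edges and the [s(v)] colors seen only at [v].  If this never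
    works, then [d(v) + s(v) >= 2N - 1 - p] for all [v], with [p = (N-1) / r]
    (resp. [p = N - 2]).  Choose for each [v] one neighbor per color seen only
    at [v], and pick [v_1, ..., v_r] so that each lies in the chosen
    neighborhoods of its predecessors and has [s] maximal among the candidates.
    The common neighborhood [W] of all of them is nonempty, and an edge in [W]
    completes a rainbow [K_k].  If [W] is independent, its vertices have small
    [d], hence large [s], which contradicts the greedy choice unless
    [r >= 2], [N = r p + 1], the graph is complete and [s] is constantly [N - p].  In
    that case, counting shows that all colors but one are used only once, and
    that the remaining one disappears with some vertex. *)

Require Import Defs.
From mathcomp Require Import all_boot.
From mathcomp Require Import zify.

Set Implicit Arguments.
Unset Strict Implicit.
Unset Printing Implicit Defensive.

(** * Finite sets: transversals and subsets of prescribed size *)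

Lemma imset_transversal (aT rT : finType) (h : aT -> rT) (S : {set aT}) :
  exists S' : {set aT},
    [/\ S' \subset S, {in S' &, injective h} & h @: S' = h @: S].
Proof.
pose g c := [pick y in S | h y == c].
have gP c y : g c = Some y -> y \in S /\ h y = c.
  by rewrite /g; case: pickP => // z /andP[zS /eqP hz] [<-].
exists [set x in S | g (h x) == Some x]; split.
- by apply/subsetP=> x /setIdP[].
- move=> x y /setIdP[_ /eqP gx] /setIdP[_ /eqP gy] hxy.
  by apply: Some_inj; rewrite -gx -gy hxy.
- apply/setP=> c; apply/imsetP/imsetP=> [[x /setIdP[xS _] ->]|[x xS ->]].
    by exists x.
  case E: (g (h x)) => [y|].
    have [yS hy] := gP _ _ E.
    by exists y; rewrite // inE yS hy E eqxx.
  by move: E; rewrite /g; case: pickP => // /(_ x); rewrite xS eqxx.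
Qed.

Lemma subset_card_exists (V : finType) (A : {set V}) j : j <= #|A| ->
  exists2 B : {set V}, B \subset A & #|B| = j.
Proof.
elim: j => [|j IH] jA; first by exists set0; rewrite ?sub0set ?cards0.
have [B BA cB] := IH (ltnW jA).
have : 0 < #|A :\: B| by rewrite cardsD (setIidPr BA) cB subn_gt0.
case/card_gt0P=> x; rewrite inE => /andP[xB xA].
by exists (x |: B); rewrite ?subUset ?sub1set ?xA // cardsU1 xB cB.
Qed.

(** * Saturated colors *)

Section Saturation.
Variables (G : sgraph) (T : finType) (K : {set G} -> T).
Implicit Types (A B W Z : {set G}) (u v x y : G).

Definition edges_in A := [set e in edges G | e \subset A].
(** Colors range over a finite type so that they can be counted as sets; [finite_palette] supplies
    one. *)
Definition colors_in A := K @: edges_in A.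
Definition nbh A v := [set u in A | adj v u].
(** The colors of [A] all of whose edges inside [A] pass through [v]. *)
Definition sat_colors A v := colors_in A :\: colors_in (A :\ v).

Definition rclique Z :=
  {in Z &, forall x y, x != y -> adj x y} /\ {in edges_in Z &, injective K}.

Lemma edgesP (e : {set G}) :
  reflect (exists x y, adj x y /\ e = [set x; y]) (e \in edges G).
Proof.
rewrite inE; apply: (iffP existsP) => [[x /existsP[y /andP[xy /eqP->]]]|].
  by exists x, y.
by move=> [x [y [xy ->]]]; exists x; apply/existsP; exists y; rewrite xy eqxx.
Qed.

Lemma adj_neq x y : adj x y -> x != y.
Proof. by apply: contraTneq => ->; rewrite adj_irrefl. Qed.

Lemma edge_card (e : {set G}) : e \in edges G -> #|e| = 2.
Proof. by case/edgesP=> x [y [/adj_neq xy ->]]; rewrite cards2 xy. Qed.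

Lemma edges_inP A (e : {set G}) :
  reflect (exists x y, [/\ x \in A, y \in A, adj x y & e = [set x; y]])
          (e \in edges_in A).
Proof.
rewrite inE; apply: (iffP andP) => [[/edgesP[x [y [xy ->]]]]|].
  by rewrite subUset !sub1set => /andP[xA yA]; exists x, y.
move=> [x [y [xA yA xy ->]]]; split; first by apply/edgesP; exists x, y.
by rewrite subUset !sub1set xA.
Qed.

Lemma edges_inS A B : A \subset B -> edges_in A \subset edges_in B.
Proof.
move=> AB; apply/subsetP=> e; rewrite !inE => /andP[-> /=] eA.
exact: subset_trans AB.
Qed.

Lemma colors_inS A B : A \subset B -> colors_in A \subset colors_in B.
Proof. by move=> AB; apply/imsetS/edges_inS. Qed.

Lemma edges_in_incident A v (e : {set G}) :
  e \in edges_in A -> e \notin edges_in (A :\ v) ->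
  exists2 u, u \in nbh A v & e = [set v; u].
Proof.
case/edges_inP=> x [y [xA yA xy ->]] nin.
have [xv|nxv] := eqVneq x v; first by exists y; rewrite ?inE -?xv ?yA.
have [yv|nyv] := eqVneq y v.
  by exists x; rewrite ?inE -?yv ?xA 1?adj_sym // setUC.
case/negP: nin; apply/edges_inP; exists x, y.
by rewrite !inE nxv nyv xA yA.
Qed.

Lemma card_edges_in_del A v : #|edges_in A| <= #|edges_in (A :\ v)| + #|nbh A v|.
Proof.
have sub : edges_in A \subset
    edges_in (A :\ v) :|: [set [set v; u] | u in nbh A v].
  apply/subsetP=> e eA; rewrite inE.
  case: (boolP (e \in edges_in (A :\ v))) => //= nin.
  by have [u uN ->] := edges_in_incident eA nin; apply: imset_f.
apply: leq_trans (subset_leq_card sub) _.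
apply: leq_trans (leq_card_setU _ _) _.
by rewrite leq_add2l leq_imset_card.
Qed.

Lemma card_colors_in_del A v :
  #|colors_in A| = #|colors_in (A :\ v)| + #|sat_colors A v|.
Proof.
rewrite -(cardsID (colors_in (A :\ v)) (colors_in A)); congr (_ + _).
by rewrite (setIidPr (colors_inS (subD1set _ _))).
Qed.

Lemma edges_in_draws A :
  edges_in A \subset [set e : {set G} | e \subset A & #|e| == 2].
Proof.
by apply/subsetP=> e /setIdP[/edge_card ce eA]; rewrite inE eA ce.
Qed.

Lemma card_edges_in A : #|edges_in A| <= 'C(#|A|, 2).
Proof. by rewrite -cards_draws; apply: subset_leq_card; apply: edges_in_draws. Qed.

Lemma card_colors_in A : #|colors_in A| <= #|edges_in A|.
Proof. exact: leq_imset_card. Qed.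

Lemma card_edges_in_clique A :
  {in A &, forall x y, x != y -> adj x y} -> #|edges_in A| = 'C(#|A|, 2).
Proof.
move=> cA; apply/eqP; rewrite eqn_leq card_edges_in /= -cards_draws.
apply/subset_leq_card/subsetP=> e /setIdP[eA /cards2P[x [y [xy ee]]]].
move: eA; rewrite ee subUset !sub1set => /andP[xA yA].
by apply/edges_inP; exists x, y; split=> //; apply: cA.
Qed.

Lemma card_nbh A v : v \in A -> #|nbh A v| < #|A|.
Proof.
move=> vA; rewrite (cardsD1 v A) vA add1n ltnS; apply/subset_leq_card/subsetP.
by move=> u; rewrite !inE => /andP[-> vu]; rewrite andbT eq_sym adj_neq.
Qed.

Lemma nbh_full A : {in A, forall v, #|A|.-1 <= #|nbh A v|} ->
  {in A &, forall x y, x != y -> adj x y}.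
Proof.
move=> full x y xA yA xy.
have sub : nbh A x \subset A :\ x.
  apply/subsetP=> u; rewrite !inE => /andP[-> vu].
  by rewrite andbT eq_sym adj_neq.
have /eqP eqN : nbh A x == A :\ x.
  rewrite eqEcard sub /=; apply: leq_trans (full x xA).
  by rewrite (cardsD1 x A) xA.
have : y \in A :\ x by rewrite !inE eq_sym xy.
by rewrite -eqN inE => /andP[].
Qed.

Lemma rcliqueS Z Z' : Z' \subset Z -> rclique Z -> rclique Z'.
Proof.
move=> sZ [cZ iZ]; split=> [x y xZ yZ|e e' eZ e'Z].
  by apply: cZ; apply: (subsetP sZ).
by apply: iZ; apply: (subsetP (edges_inS sZ)).
Qed.

(** An edge of [A] whose color is lost with [v] must contain [v], so every lost color is seen at a
    neighbor of [v]; a transversal keeps one neighbor per color. *)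
Lemma sat_nbh_ex A v : v \in A -> exists W,
  [/\ W \subset nbh A v,
      {in W, forall u, K [set v; u] \notin colors_in (A :\ v)},
      {in W &, injective (fun u => K [set v; u])}
    & #|W| = #|sat_colors A v|].
Proof.
move=> vA.
pose S := [set u in nbh A v | K [set v; u] \notin colors_in (A :\ v)].
have [W [WS Winj WK]] := imset_transversal (fun u => K [set v; u]) S.
exists W; split=> //.
- by apply/subsetP=> u /(subsetP WS) /setIdP[].
- by move=> u /(subsetP WS) /setIdP[].
rewrite -(card_in_imset Winj) WK; congr #|pred_of_set _|.
apply/setP=> c.
apply/imsetP/setDP=> [[u /setIdP[/setIdP[uA vu] nin] ->]|[/imsetP[e eA ->] nin]].
  by split=> //; apply/imset_f/edges_inP; exists v, u.
have [u uN eu] : exists2 u, u \in nbh A v & e = [set v; u].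
  by apply: edges_in_incident eA _; apply: contra nin => ein; apply: imset_f.
by exists u; rewrite -?eu // inE uN -eu.
Qed.

Lemma card_sat_colors A v : v \in A -> #|sat_colors A v| <= #|nbh A v|.
Proof. by case/sat_nbh_ex=> W [/subset_leq_card WN _ _ <-]. Qed.

(** Edges from [v] into [Z] have colors absent from [A :\ v], hence from [Z], and the choice of [W]
    makes them pairwise different. *)
Lemma rclique_extend A v W Z :
  v \in A -> W \subset nbh A v ->
  {in W, forall u, K [set v; u] \notin colors_in (A :\ v)} ->
  {in W &, injective (fun u => K [set v; u])} ->
  Z \subset W -> rclique Z -> rclique (v |: Z) /\ v \notin Z.
Proof.
move=> vA WN Wsat Winj ZW [cZ iZ].
have ZN u : u \in Z -> adj v u by move=> /(subsetP ZW)/(subsetP WN)/setIdP[].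
have ZA : Z \subset A :\ v.
  apply/subsetP=> u uZ; have /setIdP[uA vu] := subsetP WN _ (subsetP ZW _ uZ).
  by rewrite !inE uA eq_sym adj_neq.
have vZ : v \notin Z by apply/negP=> /(subsetP ZA); rewrite !inE eqxx.
split=> //; split=> [x y|e e'].
  move=> /setU1P[->|xZ] /setU1P[->|yZ]; rewrite ?eqxx // => xy.
  - exact: ZN.
  - by rewrite adj_sym ZN.
  - exact: cZ.
have split_edge f : f \in edges_in (v |: Z) ->
    f \in edges_in Z \/ exists2 u, u \in Z & f = [set v; u].
  case: (boolP (f \in edges_in Z)) => [|nin fE]; first by left.
  have := @edges_in_incident (v |: Z) v f fE; rewrite setU1K // => /(_ nin).
  case=> u /setIdP[/setU1P[->|uZ] vu] ->; first by rewrite adj_irrefl in vu.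
  by right; exists u.
have sat f u : f \in edges_in Z -> u \in Z -> K f <> K [set v; u].
  move=> fZ uZ fK; case/negP: (Wsat u (subsetP ZW _ uZ)).
  by rewrite -fK; apply/imset_f/(subsetP (edges_inS ZA)).
move=> /split_edge[eZ|[u uZ ->]] /split_edge[e'Z|[u' u'Z ->]] eK.
- exact: iZ.
- by case: (sat e u').
- by case: (sat e' u).
- by rewrite (Winj u u') // (subsetP ZW).
Qed.

Lemma rclique_edge x y : adj x y -> rclique [set x; y].
Proof.
move=> xy; split=> [a b /set2P[]-> /set2P[]->|e e']; rewrite ?eqxx // 1?adj_sym //.
have edge_eq f : f \in edges_in [set x; y] -> f = [set x; y].
  case/setIdP=> /edge_card cf fxy; apply/eqP.
  by rewrite eqEcard fxy cf cards2 adj_neq.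
by move=> /edge_eq-> /edge_eq->.
Qed.

(* [W] is the common part of the saturated neighborhoods of [j.+1] vertices
   of [A], each chosen with the largest number of saturated colors among the
   remaining candidates. *)
Lemma greedy_chain A p j :
  {in A, forall v, #|A| <= #|sat_colors A v| + p} -> j.+1 * p < #|A| ->
  exists W, [/\ W \subset A,
    forall Z, Z \subset W -> rclique Z -> exists Z',
      [/\ Z' \subset A, rclique Z' & #|Z'| = #|Z| + j.+1],
    {in A, forall u, #|A| <= #|W| + j * p + (#|A| - #|sat_colors A u|)}
  & {in W, forall x, #|A| <= #|W| + j.+1 * (#|A| - #|sat_colors A x|)}].
Proof.
move=> satp.
have step W (P : {set G}) v : #|P| = #|sat_colors A v| -> W \subset A -> P \subset A ->
    #|W| <= #|W :&: P| + (#|A| - #|sat_colors A v|).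
  move=> <- WA PA; rewrite -(cardsID P W) leq_add2l.
  have <- : #|A :\: P| = #|A| - #|P| by rewrite cardsD (setIidPr PA).
  by apply/subset_leq_card/setSD.
elim: j => [|j IH] jp.
  have /card_gt0P[v0 v0A] : 0 < #|A| by apply: leq_ltn_trans jp.
  pose a v := #|A| - #|sat_colors A v|.
  case: (@arg_minnP _ v0 (fun v => v \in A) a v0A) => v /= vA vmin.
  have [W [WN Wsat Winj Wcard]] := sat_nbh_ex vA.
  have WA : W \subset A by apply: subset_trans WN _; apply/subsetP=> u /setIdP[].
  have cW : #|A| <= #|W| + a v by have := step A W v Wcard (subxx _) WA; rewrite (setIidPr WA).
  exists W; split=> // [Z ZW rZ|u uA|x xW].
  - have [rZ' vZ] := rclique_extend vA WN Wsat Winj ZW rZ.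
    exists (v |: Z); split=> //; last by rewrite cardsU1 vZ addnC.
    by rewrite subUset sub1set vA (subset_trans ZW).
  (* The first vertex minimizes [a] over all of [A], so its loss is at most [a u] for any [u]; each
     later vertex costs at most [p]. *)
  - by rewrite mul0n addn0; apply: leq_trans cW _; rewrite leq_add2l; apply: vmin.
  - rewrite mul1n; apply: leq_trans cW _; rewrite leq_add2l; apply: vmin.
    exact: (subsetP WA).
have jp' : j.+1 * p < #|A| by apply: leq_ltn_trans jp; rewrite leq_mul2r leqnSn orbT.
have [W [WA Wext WA' WW]] := IH jp'.
pose a v := #|A| - #|sat_colors A v|.
have ap v : v \in A -> a v <= p by move=> /satp; rewrite leq_subLR.
(* So far at most [j.+1 * p < #|A|] vertices have been lost. *)
have /card_gt0P[v0 v0W] : 0 < #|W|.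
  have /card_gt0P[u uA] : 0 < #|A| by apply: leq_ltn_trans jp.
  by have := WA' u uA; have := ap u uA; rewrite /a; move: jp'; nia.
case: (@arg_minnP _ v0 (fun v => v \in W) a v0W) => v /= vW vmin.
have vA := subsetP WA v vW.
have [P [PN Psat Pinj Pcard]] := sat_nbh_ex vA.
have PA : P \subset A by apply: subset_trans PN _; apply/subsetP=> u /setIdP[].
have cW := step W P v Pcard WA PA; rewrite -/(a v) in cW.
exists (W :&: P); split.
- by apply: subset_trans WA; apply: subsetIl.
- move=> Z; rewrite subsetI => /andP[ZW ZP] rZ.
  have [rZ' vZ] := rclique_extend vA PN Psat Pinj ZP rZ.
  have [|Z' [Z'A rZ'' cZ']] := Wext (v |: Z) _ rZ'; first by rewrite subUset sub1set vW.
  by exists Z'; split=> //; rewrite cZ' cardsU1 vZ add1n addSnnS.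
- by move=> u uA; have := WA' u uA; have := ap v vA; clear -cW; rewrite mulSn; lia.
(* Since [x] was a candidate when [v] was chosen, [a v <= a x], so each of the [j.+2] losses may be
   charged as [a x]. *)
- move=> x /setIP[xW _]; have := vmin x xW; have := WW v vW; rewrite -/(a v) -/(a x).
  move=> le_n le_a; apply: leq_trans le_n _; rewrite [in leqRHS]mulSn addnA.
  apply: leq_add; last by rewrite leq_mul2l le_a orbT.
  by apply: leq_trans cW _; rewrite leq_add2l.
Qed.

Lemma rclique_or_extremal A r p : 0 < r ->
  {in A, forall v, 2 * #|A| <= #|nbh A v| + #|sat_colors A v| + p.+1} ->
  r * p < #|A| ->
  (exists Z, [/\ Z \subset A, rclique Z & #|Z| = r.+2]) \/
  #|A| = (r * p).+1 /\
  (r = 1 \/ {in A, forall v, #|A| <= #|nbh A v|.+1 /\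
                          #|sat_colors A v| + p = #|A|}).
Proof.
case: r => // j _ degp jp.
have satp : {in A, forall v, #|A| <= #|sat_colors A v| + p}.
  by move=> v vA; have := degp v vA; have := card_nbh vA; lia.
have [W [WA Wext WA' WW]] := greedy_chain satp jp.
have [x xW] : exists x, x \in W.
  apply/card_gt0P; have /card_gt0P[u uA] : 0 < #|A| by apply: leq_ltn_trans jp.
  by have := WA' u uA; have := satp u uA; move: jp; nia.
have xA := subsetP WA x xW.
case: (boolP [exists y in W, adj x y]) => [/existsP[y /andP[yW xy]]|indep].
  left; have [|Z [ZA rZ cZ]] := Wext [set x; y] _ (rclique_edge xy).
    by rewrite subUset !sub1set xW.
  by exists Z; split=> //; rewrite cZ cards2 adj_neq.
right.
have degx : #|nbh A x| + #|W| <= #|A|.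
  rewrite -(cardsID W A) (setIidPr WA) addnC leq_add2l.
  apply/subset_leq_card/subsetP=> y /setIdP[yA xy]; rewrite inE yA andbT.
  by apply: contra indep => yW; apply/existsP; exists y; rewrite yW.
have W1 : 0 < #|W| by apply/card_gt0P; exists x.
have cx := WW x xW; have dx := degp x xA.
(* By [degx] and [dx], [a + #|W|.-1 <= p]. Multiplied by [j.+1] and compared with
   [j.+1 * p < #|A| <= #|W| + j.+1 * a], this forces equality and [j * #|W|.-1 = 0]. *)
have nE : #|A| = (j.+1 * p).+1 /\ (0 < j -> #|W| = 1).
  have sx := card_sat_colors xA.
  set a := #|A| - #|sat_colors A x| in cx.
  have /(leq_mul (leqnn j.+1)) : a + #|W|.-1 <= p by rewrite /a; lia.
  rewrite mulnDr !mulSn => le_p.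
  move: cx jp W1 le_p; rewrite !mulSn; move: (a); clear.
  case: #|W| => // w a cx jp _ /= le_p.
  split=> [|j0]; first by lia.
  have : j * w = 0 by lia.
  by move/eqP; rewrite muln_eq0 => /orP[] /eqP; lia.
case: nE => nE w1; split=> //; case: (posnP j) => [->|j0]; first by left.
(* With [#|W| = 1], [WA'] caps every [#|sat_colors A v|] at [#|A| - p]; [degp] then forces a full
   neighborhood and equality in the cap. *)
right=> v vA; have := WA' v vA; have := degp v vA; have := card_nbh vA.
have := card_sat_colors vA.
by rewrite (w1 j0); move: nE; clear; rewrite mulSn; lia.
Qed.

Lemma sum_sat_colors A :
  \sum_(v in A) #|sat_colors A v| =
  \sum_(c in colors_in A) #|[set v in A | c \notin colors_in (A :\ v)]|.
Proof.
under eq_bigr do rewrite -sum1_card.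
under [RHS]eq_bigr do rewrite -sum1_card.
rewrite (exchange_big_dep (mem (colors_in A))) /=; last by move=> v c _ /setDP[].
apply: eq_bigr => c cA; apply: eq_bigl => v.
by rewrite !inE cA andbT.
Qed.

Lemma sat_vertices_sub A (e : {set G}) : e \in edges_in A ->
  [set v in A | K e \notin colors_in (A :\ v)] \subset e.
Proof.
move=> eA; apply/subsetP=> v /setIdP[vA nin].
have [|u _ ->] := @edges_in_incident A v e eA; last by rewrite !inE eqxx.
by apply: contra nin => ein; apply: imset_f.
Qed.

(* A color is lost at no more than two vertices, with equality if and only if
   it is used on a single edge. *)
Lemma rclique_of_sat_sum A : 0 < #|A| ->
  {in A &, forall x y, x != y -> adj x y} ->
  2 * #|colors_in A| <= (\sum_(v in A) #|sat_colors A v|).+1 ->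
  exists2 v, v \in A & rclique (A :\ v).
Proof.
move=> A0 cA; rewrite sum_sat_colors.
pose S c := [set v in A | c \notin colors_in (A :\ v)].
rewrite -[\sum_(c in _) _]/(\sum_(c in colors_in A) #|S c|) => sumS.
have S2 c : c \in colors_in A -> #|S c| <= 2.
  case/imsetP=> e eA ->; have /setIdP[/edge_card <- _] := eA.
  exact/subset_leq_card/sat_vertices_sub.
(* A set [S c] with two vertices lies in, hence equals, every edge of color [c]. *)
have Suniq e e' : e \in edges_in A -> e' \in edges_in A -> 2 <= #|S (K e)| ->
    K e = K e' -> e = e'.
  move=> eA e'A S2e eK.
  have SE f : f \in edges_in A -> K f = K e -> S (K e) = f.
    move=> fA fe; apply/eqP; rewrite eqEcard -fe sat_vertices_sub //= fe.
    by have /setIdP[/edge_card -> _] := fA.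
  by rewrite -(SE e) // (SE e').
(* At most one color [c0] has [#|S c0| < 2], since two would bring the sum below
   [2 * #|colors_in A| - 1]. For the same reason [S c0] is nonempty, so some [v] removes [c0]. *)
have [v vA vS] : exists2 v, v \in A &
    forall c, c \in colors_in (A :\ v) -> 2 <= #|S c|.
  case: (boolP [exists c in colors_in A, #|S c| < 2]); last first.
    move=> none; have /card_gt0P[v vA] := A0; exists v => // c cv.
    rewrite leqNgt; apply: contra none => lt2; apply/existsP; exists c.
    by rewrite lt2 (subsetP (colors_inS (subD1set A v))).
  case/existsP=> c0 /andP[c0A lt2].
  have sum_le (D : {set T}) : D \subset colors_in A ->
      \sum_(c in D) #|S c| <= 2 * #|D|.
    move=> sD; rewrite mulnC -sum_nat_const; apply: leq_sum => c cD.
    exact/S2/(subsetP sD).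
  have c0' c : c \in colors_in A -> c != c0 -> 2 <= #|S c|.
    move=> cA' cc0; rewrite leqNgt; apply/negP=> lt2'.
    move: sumS; rewrite (big_setD1 c0 c0A) (big_setD1 c) ?inE ?cc0 //=.
    have := sum_le _ (subset_trans (subD1set (colors_in A :\ c0) c) (subD1set _ _)).
    rewrite (cardsD1 c0 (colors_in A)) c0A (cardsD1 c (_ :\ c0)) !inE cc0 cA' /=; lia.
  have /card_gt0P[v /setIdP[vA nin]] : 0 < #|S c0|.
    move: sumS; rewrite (big_setD1 c0 c0A) /= (cardsD1 c0 (colors_in A)) c0A.
    by have := sum_le (colors_in A :\ c0) (subD1set _ _); lia.
  exists v => // c cv; apply: c0'; first exact: (subsetP (colors_inS (subD1set A v))).
  by apply: contraNneq nin => <-.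
exists v => //; split=> [x y /setD1P[_ xA] /setD1P[_ yA]|e e' eE e'E eK].
  exact: cA.
apply: (Suniq e e' _ _ _ eK).
- exact: (subsetP (edges_inS (subD1set A v))).
- exact: (subsetP (edges_inS (subD1set A v))).
- exact/vS/imset_f.
Qed.

End Saturation.

(** * Rainbow cliques from the Turan number *)

(* The Turan graph with residues mod [r] as parts: vertex [j] has [j - j %/ r]
   neighbors below it. *)
Definition turan r n := \sum_(j < n) (j - j %/ r).

Lemma turanS r n : turan r n.+1 = turan r n + (n - n %/ r).
Proof. exact: big_ord_recr. Qed.

(** For [i < s.+1], vertex [s.+1 * p + i] has [s * p + i] lower neighbors; the [+ j] on the left
    avoids a subtraction. *)
Lemma turan_mul_add s p j : j <= s.+1 ->
  2 * turan s.+1 (s.+1 * p + j) + j =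
  2 * turan s.+1 (s.+1 * p) + 2 * (j * (s * p)) + j * j.
Proof.
elim: j => [|j IH] js; first by rewrite !mul0n muln0 !addn0.
rewrite (addnS (s.+1 * p)) turanS (mulnC s.+1 p) divnMDl // divn_small // addn0 (mulnC p).
have -> : s.+1 * p + j - p = s * p + j by rewrite mulSn -addnA addKn.
by have := IH (ltnW js); rewrite mulSn; lia.
Qed.

Lemma turan_mul s p : 2 * turan s.+1 (s.+1 * p) = s * s.+1 * (p * p).
Proof.
elim: p => [|p IH]; first by rewrite !muln0 /turan big_ord0.
have := turan_mul_add p (leqnn s.+1); rewrite IH -mulnSr; nia.
Qed.

(** The right side is the sum of [N - p] over the [N = s.+1 * p + 1] vertices of the extremal
    case. *)
Lemma turan_mul1 s p :
  2 * turan s.+1 (s.+1 * p).+1 + p.+1 = (s.+1 * p).+1 * (s * p).+1.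
Proof.
have := @turan_mul_add s p 1 isT; rewrite turan_mul (addn1 (_ * p)).
by move: (turan _ _); nia.
Qed.

Section MainInduction.
Variables (G : sgraph) (T : finType) (K : {set G} -> T).
Implicit Types A : {set G}.

Lemma card_del_failure A f :
  {in A, forall v, #|edges_in (A :\ v)| + #|colors_in K (A :\ v)| < f} ->
  {in A, forall v, #|edges_in A| + #|colors_in K A| <
                   f + #|nbh A v| + #|sat_colors K A v|}.
Proof.
move=> lt_f v vA; rewrite (card_colors_in_del K A v).
by have := card_edges_in_del A v; have := lt_f v vA; lia.
Qed.

Lemma rainbow_clique_turan r A : 1 < r ->
  'C(#|A|, 2) + turan r #|A| + 2 <= #|edges_in A| + #|colors_in K A| ->
  exists Z : {set G}, [/\ Z \subset A, rclique K Z & #|Z| = r.+2].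
Proof.
case: r => // s r1.
move: {2}#|A| (erefl #|A|) => n; elim: n => [|n IH] in A *.
  move=> cA; have := card_edges_in A; have := card_colors_in K A.
  by rewrite cA bin_small //; lia.
move=> cA; rewrite cA => le_ec.
case: (boolP [exists v in A, 'C(n, 2) + turan s.+1 n + 2
    <= #|edges_in (A :\ v)| + #|colors_in K (A :\ v)|]) => [|none].
  case/existsP=> v /andP[vA le_v].
  have cAv : #|A :\ v| = n by move: cA; rewrite (cardsD1 v) vA => -[].
  have [|Z [ZA rZ cZ]] := IH (A :\ v) cAv; first by rewrite cAv.
  by exists Z; split=> //; apply: subset_trans ZA (subD1set _ _).
have large : {in A, forall v, #|edges_in A| + #|colors_in K A| <
    'C(n, 2) + turan s.+1 n + 2 + #|nbh A v| + #|sat_colors K A v|}.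
  apply: card_del_failure => v vA; rewrite ltnNge.
  by apply: contra none => le_v; apply/existsP; exists v; rewrite vA.
(* The threshold grows by [2 * n - p] from [n] to [n.+1] vertices. *)
set p := n %/ s.+1.
have le_p : p <= n := leq_div n s.+1.
have large' : {in A, forall v,
    2 * #|A| <= #|nbh A v| + #|sat_colors K A v| + p.+1}.
  move=> v vA; have := large v vA; rewrite cA; move: le_ec.
  by rewrite turanS (binS n) (bin1 n) -/p; lia.
have rp : s.+1 * p < #|A| by rewrite cA ltnS mulnC leq_trunc_div.
case: (rclique_or_extremal (ltn0Sn s) large' rp) => // -[nE]; case=> [r1'|ext].
  by rewrite r1' in r1.
have cliqueA : {in A &, forall x y, x != y -> adj x y}.
  by apply: nbh_full => v vA; have [] := ext v vA; lia.
have eE := card_edges_in_clique cliqueA.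
have T1 := turan_mul1 s p.
have /card_gt0P[v0 v0A] : 0 < #|A| by rewrite cA.
have A0 : 0 < #|A| by rewrite cA.
have le_c : #|colors_in K A| <= turan s.+1 n.+1 + 2.
  have [d1 s1] := ext v0 v0A; have := large v0 v0A; have := card_nbh v0A.
  by rewrite eE cA turanS (binS n) (bin1 n) -/p; lia.
(* For [p <= 1] the Turan graph misses at most one pair, so [turan + 2] colors would outnumber the
   edges. From [p >= 2], [turan_mul1] gives the sum that [rclique_of_sat_sum] asks for. *)
have p2 : 1 < p.
  have le_TC : turan s.+1 n.+1 + 2 <= 'C(n.+1, 2).
    by have := card_colors_in K A; move: le_ec; rewrite eE cA; lia.
  have := mul_bin_diag n.+1 1; move: T1 le_TC; rewrite -nE cA /= bin1.
  have {nE} : n = s.+1 * p by move: nE; rewrite cA => -[].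
  move: (turan _ _) 'C(_, _) (p) => t b q -> {IH le_ec none large large' cA}.
  by case: q => [|[|q]] // *; nia.
have sumE : \sum_(v in A) #|sat_colors K A v| = (s.+1 * p).+1 * (s * p).+1.
  rewrite (eq_bigr (fun=> (s * p).+1)) => [|v vA]; first by rewrite sum_nat_const nE.
  by have [_] := ext v vA; rewrite nE mulSn; lia.
have [|v vA rAv] := @rclique_of_sat_sum _ _ K _ A0 cliqueA.
  by rewrite sumE -T1 -nE cA; lia.
(* [A :\ v] has [s.+1 * p >= s.+3] vertices, as both factors are at least 2. *)
have [|Z ZA cZ] := @subset_card_exists G (A :\ v) s.+3.
  by have := cardsD1 v A; rewrite vA nE; nia.
exists Z; split=> //; last exact: rcliqueS rAv.
exact: subset_trans ZA (subD1set _ _).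
Qed.

Lemma rainbow_triangle A : 0 < #|A| ->
  'C(#|A|, 2) + #|A| <= #|edges_in A| + #|colors_in K A| ->
  exists Z : {set G}, [/\ Z \subset A, rclique K Z & #|Z| = 3].
Proof.
move: {2}#|A| (erefl #|A|) => n; elim: n => [|n IH] in A *; first by move=> ->.
move=> cA _; rewrite cA => le_ec.
case: (posnP n) => [n0|n0].
  have := card_edges_in A; have := card_colors_in K A.
  by move: le_ec; rewrite cA n0 bin_small //; lia.
case: (boolP [exists v in A, 'C(n, 2) + n
    <= #|edges_in (A :\ v)| + #|colors_in K (A :\ v)|]) => [|none].
  case/existsP=> v /andP[vA le_v].
  have cAv : #|A :\ v| = n by move: cA; rewrite (cardsD1 v) vA => -[].
  have [||Z [ZA rZ cZ]] := IH (A :\ v) cAv; try by rewrite cAv.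
  by exists Z; split=> //; apply: subset_trans ZA (subD1set _ _).
have large : {in A, forall v, #|edges_in A| + #|colors_in K A| <
    'C(n, 2) + n + #|nbh A v| + #|sat_colors K A v|}.
  apply: card_del_failure => v vA; rewrite ltnNge.
  by apply: contra none => le_v; apply/existsP; exists v; rewrite vA.
(* Here the threshold grows by [n.+1], which gives [p = n.-1]. *)
have large' : {in A, forall v,
    2 * #|A| <= #|nbh A v| + #|sat_colors K A v| + n.-1.+1}.
  move=> v vA; have := large v vA; rewrite cA; move: le_ec.
  by rewrite (binS n) (bin1 n); lia.
(* The extremal alternative would give [#|A| = n], against [#|A| = n.+1]. *)
case: (@rclique_or_extremal _ _ K A 1 n.-1 isT large'); rewrite ?cA; try lia; by [].
Qed.
End MainInduction.

(** * Lower bounds on [rb] *)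

Lemma ltn_ncolors_rb (N k : nat) (C : coloring (complete N)) :
  (forall S : subgraph (complete N), ~ is_rainbow_copy (complete k) C S) ->
  ncolors C < rb (complete N) (complete k).
Proof.
move=> none; rewrite ltnNge; apply/negP => le_c.
by have [f _] := rbP (complete N) (complete k); have [S /none] := f C le_c.
Qed.

Lemma leq_ncolors (G : sgraph) (C : coloring G) (s : seq nat) :
  uniq s -> {in s, forall c, exists2 e, e \in edges G & C e = c} ->
  size s <= ncolors C.
Proof.
move=> us sC; apply: uniq_leq_size => // c /sC[e eG <-].
by rewrite mem_undup map_f // mem_enum.
Qed.

Lemma edge_complete N (x y : complete N) :
  x != y -> [set x; y] \in edges (complete N).
Proof. by move=> xy; apply/edgesP; exists x, y. Qed.

Lemma rainbow_copy_inj N k (C : coloring (complete N)) S :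
  is_rainbow_copy (complete k) C S ->
  exists f : 'I_k -> 'I_N, injective f /\
    forall a b c d, a != b -> c != d ->
      C [set f a; f b] = C [set f c; f d] -> [set a; b] = [set c; d].
Proof.
move=> [[f [finj _ fE]] rS]; exists f; split=> // a b c d ab cd eC.
have inS (u v : complete k) : u != v -> [set f u; f v] \in sedges S.
  move=> uv; rewrite -fE; apply/imsetP; exists [set u; v]; first exact: edge_complete.
  by rewrite imsetU !imset_set1.
have := rS _ _ (inS a b ab) (inS c d cd) eC.
by rewrite -!imset_set1 -!imsetU => /(imset_inj finj).
Qed.

(** In any triangle the two edges at the largest vertex share their color, while the edges at vertex
    0 already show one color per other vertex. *)
Lemma leq_rb_triangle N : 0 < N -> N <= rb (complete N) (complete 3).
Proof.
case: N => // N _.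
pose C (e : {set complete N.+1}) : nat := \max_(i in e) (i : 'I_N.+1).
have Cpair (x y : complete N.+1) : C [set x; y] = maxn (x : 'I_N.+1) (y : 'I_N.+1).
  have [->|xy] := eqVneq x y; first by rewrite /C setUid big_set1 maxnn.
  by rewrite /C big_setU1 ?inE //= big_set1.
have leC : N <= ncolors (C : coloring (complete N.+1)).
  have := @leq_ncolors (complete N.+1) C (iota 1 N) (iota_uniq 1 N).
  rewrite size_iota; apply=> c; rewrite mem_iota => /andP[c0 cN].
  have nz : ord0 != Ordinal cN :> 'I_N.+1 by rewrite -val_eqE /= eq_sym -lt0n.
  exists [set (ord0 : complete N.+1); (Ordinal cN : complete N.+1)].
    exact: edge_complete.
  by rewrite Cpair max0n.
apply: leq_ltn_trans leC _; apply: ltn_ncolors_rb => S /rainbow_copy_inj[f [finj fC]].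
case: (@arg_maxnP _ (ord0 : 'I_3) xpredT (fun i => f i : nat) isT) => i _ imax.
have [j [k [ij ik jk]]] : exists j k : 'I_3, [/\ i != j, i != k & j != k].
  exists (inord (i.+1 %% 3)), (inord (i.+2 %% 3)).
  by case: i {imax} => [[|[|[|]]]] // ?; rewrite -!val_eqE /= !inordK.
have : [set i; j] = [set i; k].
  by apply: fC => //; rewrite !Cpair !(maxn_idPl _) //; apply: imax.
move/setP/(_ j); rewrite !inE eqxx orbT [j == i]eq_sym (negPf ij) (negPf jk).
by [].
Qed.

Lemma ltn_div_congr r i j : 0 < r -> i < j -> i == j %[mod r] ->
  i %/ r < j %/ r.
Proof.
move=> r0 ij /eqP e; move: ij.
by rewrite {1}(divn_eq i r) {1}(divn_eq j r) e ltn_add2r ltn_mul2r r0.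
Qed.

(** For [r > 0], within a residue class [i] is determined by [i %/ r], which stays below
    [j %/ r]. *)
Lemma card_same_residue r (j : nat) : 
  #|[set i : 'I_j | i == j %[mod r]]| <= j %/ r.
Proof.
have [->|r0] := posnP r.
  rewrite leqn0 cards_eq0; apply/eqP/setP => i; rewrite !inE !modn0.
  by rewrite ltn_eqF.
case: (posnP (j %/ r)) => [jr0|jr].
  rewrite jr0 leqn0 cards_eq0; apply/eqP/setP => i; rewrite !inE.
  move: jr0 (ltn_ord i) => /eqP; rewrite -leqn0 leqNgt divn_gt0 // -ltnNge => jr ij.
  by rewrite !modn_small // ?(ltn_trans ij) // ltn_eqF.
rewrite -(prednK jr) -[leqRHS]card_ord.
rewrite -(card_in_imset (f := fun i : 'I_j => inord (i %/ r) : 'I_(j %/ r).-1.+1)).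
  exact: max_card.
move=> x y; rewrite !inE => xj yj /(congr1 val) /=.
rewrite !inordK ?prednK ?ltn_div_congr // => exy; apply: val_inj => /=.
by rewrite (divn_eq x r) (divn_eq y r) exy (eqP xj) (eqP yj).
Qed.

(** The edges of the Turan graph, each recorded once with its larger endpoint first. *)
Definition cross r N :=
  [set p : 'I_N * 'I_N | (p.2 < p.1) && (p.2 != p.1 %[mod r])].

Lemma leq_turan_cross r N : turan r N <= #|cross r N|.
Proof.
rewrite -sum1_card (eq_bigl (fun p : 'I_N * 'I_N =>
  true && ((p.2 < p.1) && (p.2 != p.1 %[mod r])))); last by move=> p; rewrite inE.
rewrite -(pair_big_dep xpredT (fun j i : 'I_N => (i < j) && (i != j %[mod r]))
  (fun _ _ => 1)) /=.
apply: leq_sum => j _; rewrite sum1dep_card.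
have le_jN : j <= N := ltnW (ltn_ord j).
have winj : injective (widen_ord le_jN).
  by move=> x y /(congr1 val) /= xy; apply: val_inj.
pose D := [set i : 'I_j | i == j %[mod r]].
apply: (@leq_trans #|~: D|).
  by rewrite cardsCs setCK card_ord leq_sub2l // card_same_residue.
rewrite -(card_imset _ winj); apply/subset_leq_card/subsetP => _ /imsetP[i iD ->].
by move: iD; rewrite !inE /= ltn_ord.
Qed.

Lemma pigeonhole (aT rT : finType) (g : aT -> rT) (D : {set aT}) :
  #|rT| < #|D| -> exists a b, [/\ a \in D, b \in D, a != b & g a = g b].
Proof.
move=> ltD; case: (boolP (dinjectiveb g (mem D))) => [/dinjectiveP ginj|].
  by move: ltD; rewrite -(card_in_imset ginj) ltnNge max_card.
case/dinjectivePn=> a aD [b /andP[ba bD] gab].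
by exists a, b; split; rewrite // eq_sym.
Qed.

(** Cross edges get private colors and all edges inside parts get color 0. Among [r.+2] vertices two
    different pairs lie inside parts, so color 0 repeats. *)
Lemma leq_rb_turan r N : 0 < r -> r < N ->
  turan r N + 2 <= rb (complete N) (complete r.+2).
Proof.
move=> r0 rN.
pose C (e : {set complete N}) : nat :=
  if [pick p in cross r N | e == [set p.1; p.2]] is Some p
  then (enum_rank p).+1 else 0.
have Ccross (p : 'I_N * 'I_N) : p \in cross r N ->
    C [set (p.1 : complete N); (p.2 : complete N)] = (enum_rank p).+1.
  move=> pX; rewrite /C; case: pickP => [q /andP[qX /eqP]|/(_ p)]; last first.
    by rewrite pX eqxx.
  case: p q pX qX => [a b] [c d] /setIdP[/= ba _] /setIdP[/= dc _] E.
  congr (enum_rank _).+1.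
  have : c \in [set a; b] by rewrite E !inE eqxx.
  have : d \in [set a; b] by rewrite E !inE eqxx orbT.
  rewrite !inE => /orP[]/eqP dE /orP[]/eqP cE;
    move: dc; rewrite dE cE ?ltnn // => ab.
  by have := ltn_trans ab ba; rewrite ltnn.
have Csame (x y : complete N) : (x : 'I_N) == (y : 'I_N) %[mod r] -> C [set x; y] = 0.
  move=> xy; rewrite /C; case: pickP => // [[a b]] /andP[/setIdP[/= ba ab] /eqP E].
  case/negP: ab.
  have : a \in [set x; y] by rewrite E !inE eqxx.
  have : b \in [set x; y] by rewrite E !inE eqxx orbT.
  by rewrite !inE => /orP[]/eqP-> /orP[]/eqP->; rewrite // eq_sym.
have leC : turan r N < ncolors (C : coloring (complete N)).
  pose s := 0 :: [seq (enum_rank p).+1 | p <- enum (cross r N)].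
  apply: (@leq_trans (size s)).
    by rewrite /s /= size_map -cardE ltnS leq_turan_cross.
  apply: leq_ncolors.
    rewrite /s /= map_inj_uniq ?enum_uniq ?andbT.
      by apply/mapP=> -[].
    by move=> p q [] /ord_inj /enum_rank_inj.
  move=> c; rewrite inE => /orP[/eqP->|/mapP[p pX ->]].
    (* Vertices 0 and [r] lie in the same part, so color 0 does occur. *)
    have N0 : 0 < N by apply: leq_ltn_trans rN.
    exists [set (Ordinal N0 : complete N); (Ordinal rN : complete N)].
      by apply: edge_complete; rewrite -val_eqE /= eq_sym -lt0n.
    by apply: Csame; rewrite /= modnn mod0n.
  rewrite mem_enum in pX; exists [set (p.1 : complete N); (p.2 : complete N)].
    apply: edge_complete; have /setIdP[/ltn_eqF + _] := pX.
    by rewrite -val_eqE eq_sym /= => ->.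
  exact: Ccross.
rewrite addn2; apply: leq_ltn_trans leC _.
apply: ltn_ncolors_rb => S /rainbow_copy_inj[f [finj fC]].
pose g i : 'I_r := Ordinal (ltn_pmod (f i) r0).
have gC a b : g a = g b -> C [set (f a : complete N); (f b : complete N)] = 0.
  by move/(congr1 val) => /= gab; apply: Csame; apply/eqP.
have [|a [b [_ _ ab gab]]] := @pigeonhole _ _ g setT.
  by rewrite cardsT !card_ord.
(* Setting [a] aside leaves [r.+1] vertices, whose pair differs from [[set a; b]]. *)
have [|c [d [ca da cd gcd]]] := @pigeonhole _ _ g (~: [set a]).
  by rewrite cardsC1 !card_ord.
have := fC a b c d ab cd; rewrite !gC // => /(_ erefl) /setP /(_ a).
move: ca da; rewrite !inE eqxx => /negPf ca /negPf da.
by rewrite ![a == _]eq_sym ca da.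
Qed.

(** * Vertex-disjoint rainbow cliques *)

Lemma card_outside (G : sgraph) (B : {set G}) :
  #|edges G :\: edges_in B| <= 'C(#|G|, 2) - 'C(#|B|, 2).
Proof.
pose D (A : {set G}) := [set e : {set G} | e \subset A & #|e| == 2].
have cD (A : {set G}) : #|D A| = 'C(#|A|, 2) by apply: cards_draws.
have sD : D B \subset D setT.
  by apply/subsetP=> e /setIdP[_ e2]; rewrite inE subsetT.
apply: (@leq_trans #|D setT :\: D B|); last first.
  by rewrite cardsD (setIidPr sD) !cD cardsT.
apply/subset_leq_card/subsetP => e /setDP[eG nin].
apply/setDP; split; first by rewrite inE subsetT edge_card.
by apply: contra nin => /setIdP[eB _]; apply/setIdP.
Qed.

(** Each edge not inside [B] accounts for at most one lost edge and one lost color, hence the factor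
    2. *)
Lemma induced_edges_colors (G : sgraph) (T : finType) (K : {set G} -> T)
    (B : {set G}) :
  #|edges G| + #|K @: edges G| <=
  #|edges_in B| + #|colors_in K B| + 2 * ('C(#|G|, 2) - 'C(#|B|, 2)).
Proof.
have sB : edges_in B \subset edges G by apply/subsetP=> e /setIdP[].
have cE : #|edges G| = #|edges_in B| + #|edges G :\: edges_in B|.
  by rewrite -(cardsID (edges_in B) (edges G)) (setIidPr sB).
have cK : #|K @: edges G| <= #|colors_in K B| + #|edges G :\: edges_in B|.
  rewrite -[edges G in X in X <= _](setID _ (edges_in B)) (setIidPr sB) imsetU.
  by apply: leq_trans (leq_card_setU _ _) _; rewrite leq_add2l leq_imset_card.
by have := card_outside B; lia.
Qed.

(** The case [k = 3] is separate because [turan 1 n = 0]; there the bound on [rb] comes from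
    [leq_rb_triangle]. *)
Lemma rainbow_clique_in (G : sgraph) (T : finType) (K : {set G} -> T) k
    (B : {set G}) :
  3 <= k <= #|B| ->
  'C(#|B|, 2) + rb (complete #|B|) (complete k) <= #|edges_in B| + #|colors_in K B| ->
  exists Z : {set G}, [/\ Z \subset B, rclique K Z & #|Z| = k].
Proof.
case: k => [|[|[|k]]] //=; case: k => [|k] kB le_B.
  have B0 : 0 < #|B| by apply: leq_trans kB.
  apply: rainbow_triangle => //; apply: leq_trans le_B.
  by rewrite leq_add2l leq_rb_triangle.
apply: (@rainbow_clique_turan G T K k.+2) => //; apply: leq_trans le_B.
by rewrite -addnA leq_add2l leq_rb_turan // (leq_trans _ kB).
Qed.

Lemma rainbow_copy_of_rclique (G : sgraph) (T : finType) (K : {set G} -> T)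
    (C : coloring G) (Z : {set G}) :
  {in edges G &, forall e e', C e = C e' -> K e = K e'} -> rclique K Z ->
  exists2 S : subgraph G, sverts S = Z & is_rainbow_copy (complete #|Z|) C S.
Proof.
move=> CK [cZ iZ].
have sE : edges_in Z \subset edges G by apply/subsetP=> e /setIdP[].
have sV : {in edges_in Z, forall e : {set G}, e \subset Z} by move=> e /setIdP[].
exists (Subgraph sE sV) => //; split; last first.
  by move=> e e' eZ e'Z /CK eK; apply: iZ; rewrite // eK // (subsetP sE).
exists (fun i : 'I_#|Z| => enum_val i); split; first exact: enum_val_inj.
  apply/setP=> x; apply/imsetP/idP => [[i _ ->]|xZ]; first exact: enum_valP.
  by exists (enum_rank_in xZ x); rewrite // enum_rankK_in.
apply/setP=> e; apply/imsetP/edges_inP => [[_ /edgesP[i [j [ij ->]]] ->]|].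
  exists (enum_val i), (enum_val j); rewrite !enum_valP; split=> //.
    by apply: cZ; rewrite ?enum_valP // (inj_eq enum_val_inj).
  by rewrite imsetU !imset_set1.
move=> [x [y [xZ yZ xy ->]]].
exists [set (enum_rank_in xZ x : complete #|Z|); enum_rank_in xZ y].
  apply: edge_complete; apply: contraTneq (adj_neq xy) => exy.
  by rewrite negbK -(enum_rankK_in xZ xZ) exy enum_rankK_in.
by rewrite imsetU !imset_set1 !enum_rankK_in.
Qed.

Lemma ncolors_imset (G : sgraph) (C : coloring G) (T : finType)
    (K : {set G} -> T) :
  {in edges G &, forall e e', K e = K e' -> C e = C e'} ->
  ncolors C <= #|K @: edges G|.
Proof.
pose h t := if [pick e in edges G | K e == t] is Some e then C e else 0.
move=> KC; rewrite cardE -(size_map h); apply: uniq_leq_size => [|c].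
  exact: undup_uniq.
rewrite mem_undup => /mapP[e]; rewrite mem_enum => eG ->.
apply/mapP; exists (K e); first by rewrite mem_enum imset_f.
rewrite /h; case: pickP => [e' /andP[e'G /eqP/KC ->] //|/(_ e)].
by rewrite eG eqxx.
Qed.

(** Colors on edges are bounded by their maximum, so [inord] is faithful on them. *)
Lemma finite_palette (G : sgraph) (C : coloring G) :
  exists (T : finType) (K : {set G} -> T),
    {in edges G &, forall e e', (K e == K e') = (C e == C e')}.
Proof.
pose M := \max_(e in edges G) C e.
exists 'I_M.+1, (fun e => inord (C e)) => e e' eG e'G.
by rewrite -val_eqE /= !inordK // ltnS; apply: leq_bigmax_cond.
Qed.

(** Each copy uses up [k] vertices and [N] must remain when the last one is chosen; the [+ k] avoids
    writing [m - 1]. *)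
Lemma disjoint_copies (V : finType) (P : {set V} -> Prop) N k m (A : {set V}) :
  (forall B : {set V}, #|B| = N ->
     exists Z : {set V}, [/\ Z \subset B, #|Z| = k & P Z]) ->
  N + k * m <= #|A| + k ->
  exists Z : 'I_m -> {set V},
    [/\ forall i, Z i \subset A, forall i, #|Z i| = k /\ P (Z i)
      & forall i j, i != j -> [disjoint Z i & Z j]].
Proof.
move=> PN; elim: m A => [|m IH] A NA.
  by exists (fun=> set0); split=> -[].
rewrite mulnSr addnA leq_add2r in NA.
have [B BA cB] := subset_card_exists (leq_trans (leq_addr _ _) NA).
have [Z0 [Z0B cZ0 PZ0]] := PN B cB; have Z0A := subset_trans Z0B BA.
have [|Z [ZA PZ Zdisj]] := IH (A :\: Z0).
  by rewrite cardsD (setIidPr Z0A) cZ0 subnK // -cZ0 subset_leq_card.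
have Z0Z i : [disjoint Z0 & Z i].
  by rewrite disjoint_sym; have := ZA i; rewrite subsetD => /andP[].
exists (fun i => if unlift ord0 i is Some j then Z j else Z0); split=> [i|i|i j].
- case: unliftP => // j _; exact: subset_trans (ZA j) (subsetDl _ _).
- by case: unliftP.
- case: unliftP => [i' ->|->]; case: unliftP => [j' ->|->]; rewrite ?eqxx //.
  + by rewrite (inj_eq lift_inj); apply: Zdisj.
  + by rewrite disjoint_sym.
Qed.

(** The difference of binomials counts the pairs meeting [a] removed vertices; with
    [a = k * (m - 1)] this explains the correction terms of the theorem. *)
Lemma bin2_sub n a : a <= n ->
  a * (2 * n - 1) = 2 * ('C(n, 2) - 'C(n - a, 2)) + a ^ 2.
Proof.
move=> /subnK <-; move: (n - a) => b; rewrite addnK (mulnBr 2 'C(_, _)).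
have := mul_bin_diag (b + a) 1; have := mul_bin_diag b 1.
by rewrite !bin1 => <- <-; case: b => [|b]; case: a => [|a] /=; nia.
Qed.

Theorem proposition1p5 (k m n : nat) (G : sgraph) (C : coloring G)
  (hk : 3 <= k) (hm : 1 <= m) (hG : #|G| = n) (hn : k * m <= n)
  (hec : 'C(n - k * (m - 1), 2)
         + rb (complete (n - k * (m - 1))) (complete k)
         + k * (m - 1) * (2 * n - 1) - k ^ 2 * (m - 1) ^ 2
         <= #|edges G| + ncolors C) :
  exists S : 'I_m -> subgraph G,
    (forall i, is_rainbow_copy (complete k) C (S i)) /\
    (forall i j, i != j -> [disjoint sverts (S i) & sverts (S j)]).
Proof.
have [T [K KC]] := finite_palette C.
set a := k * (m - 1) in hec; set N := n - a in hec.
have an : k + a <= n by rewrite /a subn1 -mulnS prednK.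
have NA : N + k * m <= #|[set: G]| + k.
  by rewrite cardsT hG -(prednK hm) mulnS -subn1 -/a; lia.
have PN (B : {set G}) : #|B| = N ->
    exists Z : {set G}, [/\ Z \subset B, #|Z| = k & rclique K Z].
  move=> cB; have [||Z [ZB rZ cZ]] := @rainbow_clique_in G T K k B.
  - by rewrite hk cB /N leq_subRL; lia.
  - have := induced_edges_colors K B.
    have : ncolors C <= #|K @: edges G|.
      by apply: ncolors_imset => e e' eG e'G /eqP; rewrite KC // => /eqP.
    (* This also shows that the truncated subtraction in [hec] is exact. *)
    have := bin2_sub (leq_trans (leq_addl _ _) an); rewrite cB hG -/N.
    by rewrite -expnMn -/a in hec; lia.
  - by exists Z.
have [Z [_ PZ Zdisj]] := disjoint_copies PN NA.
have copy i : exists S : subgraph G,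
    sverts S = Z i /\ is_rainbow_copy (complete k) C S.
  have [<- rZ] := PZ i; have [|S SZ rS] := rainbow_copy_of_rclique (C := C) _ rZ.
    by move=> e e' eG e'G /eqP; rewrite -KC // => /eqP.
  by exists S.
have [S SP] := boolp.choice copy.
exists S; split=> [i|i j ij]; first by have [] := SP i.
by have [-> _] := SP i; have [-> _] := SP j; apply: Zdisj.
Qed.
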